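(* Let $G_2$ be a torsion-free, finitely generated nilpotent group, let $G_1 \lhd G_2$ be a normal subgroup of finite index, and let $H \leq \mathrm{Aut}(G_2)$ be a subgroup. If $G_1$ is $H$-invariant (i.e. $\xi(G_1)=G_1$ for all $\xi\in H$), then $\mathrm{RF}_{G_1, \mathcal{P}_{H\curvearrowright G_1}} \approx \mathrm{RF}_{G_2, \mathcal{P}_{H\curvearrowright G_2}}$, where $H$ acts on $G_1$ by restriction.
   Context: Let $G$ be a finitely generated residually finite group with finite generating set $S$. The word norm is $\|g\|_{G,S} = \min\{k\ge 0 \mid g = s_1\cdots s_k,\ s_i\in S\cup S^{-1}\}$. For a set $\mathcal{P}$ of normal subgroups of $G$ and $g\in G\setminus\{e\}$ put $D_{G,\mathcal{P}}(g) = \min\{[G:N] \mid N\in\mathcal{P},\ g\notin N\}$ ($\min\emptyset=\infty$). Define $\mathrm{RF}_{G,\mathcal{P},S}(r) = \max\{D_{G,\mathcal{P}}(g)\mid 0<\|g\|_{G,S}\le r\}$ for real $r\ge 1$, with the convention $\max\emptyset = 1$. For non-decreasing functions $f,g$ on $[1,\infty)$ with values in $[0,\infty]$, write $f\preceq g$ if there exists $C>0$ such that $f(r)\le C g(Cr)$ for all $r\ge \max\{1,1/C\}$, and $f\approx g$ if $f\preceq g$ and $g\preceq f$. Up to $\approx$, $\mathrm{RF}_{G,\mathcal{P},S}$ does not depend on $S$ and is denoted $\mathrm{RF}_{G,\mathcal{P}}$. If a group $H$ acts on $G$ by automorphisms, $\mathcal{P}_{H\curvearrowright G}$ is the set of $H$-invariant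 normal subgroups of $G$, i.e. those $N\lhd G$ with $\xi(N)=N$ for all $\xi\in H$. *)

(* Defs.v *)
From mathcomp Require Import all_boot all_order all_algebra.
From mathcomp Require Import all_classical all_reals.
From mathcomp Require Import ereal counting_measure.

Set Implicit Arguments.
Unset Strict Implicit.
Unset Printing Implicit Defensive.

Import Order.TTheory GRing.Theory Num.Theory.

Local Open Scope classical_set_scope.
Local Open Scope ring_scope.

Section Groups.
Variable G : groupType.
Implicit Types (N A S : set G) (g : G).

Definition is_subgroup N : Prop :=
  [/\ N 1%g, (forall x y, N x -> N y -> N (x * y)%g)
    & forall x, N x -> N (x^-1)%g].

Definition is_normal N : Prop :=
  is_subgroup N /\ forall x g, N x -> N (x ^ g)%g.

Definition generated A : set G := smallest is_subgroup A.

Definition finite_generating_set S : Prop :=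
  finite_set S /\ generated S = [set: G].

Definition finitely_generated : Prop := exists S, finite_generating_set S.

Definition torsion_free : Prop :=
  forall (x : G) (n : nat), (0 < n)%N -> (x ^+ n = 1)%g -> x = 1%g.

Fixpoint lower_central (n : nat) : set G :=
  if n is m.+1 then
    generated [set z | exists x y, lower_central m x /\ z = [~ x, y]%g]
  else [set: G].

Definition is_nilpotent : Prop := exists n, lower_central n = [set 1%g].

Definition left_cosets N : set (set G) :=
  range (fun g => [set (g * x)%g | x in N]).

Definition finite_index N : Prop := finite_set (left_cosets N).

Definition automorphisms : set (G -> G) :=
  [set f | bijective f /\ {morph f : x y / (x * y)%g}].

Definition is_aut_subgroup (H : set (G -> G)) : Prop :=
  [/\ H `<=` automorphisms, H id,
      (forall f h, H f -> H h -> H (f \o h))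
    & forall f, H f -> exists2 h, H h & cancel f h /\ cancel h f].

Definition is_invariant (H : set (G -> G)) N : Prop :=
  forall xi, H xi -> xi @` N = N.

Definition invariant_normals (H : set (G -> G)) : set (set G) :=
  [set N | is_normal N /\ is_invariant H N].

End Groups.

Arguments finitely_generated : clear implicits.
Arguments torsion_free : clear implicits.
Arguments is_nilpotent : clear implicits.

(* Self-maps of the subgroup G1 obtained by restricting the maps in H. When G1
   is H-invariant, each map in H has exactly one restriction. *)
Definition restrictions (G : groupType) (P : pred G) (G1 : subGroupType P)
    (H : set (G -> G)) : set (G1 -> G1) :=
  [set h | exists2 xi, H xi & forall x : G1, val (h x) = xi (val x)].

Section ResidualFiniteness.
Variables (R : realType) (G : groupType).
Implicit Types (P : set (set G)) (S : set G) (g : G).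

Local Open Scope ereal_scope.

Definition group_index (N : set G) : \bar R := counting (left_cosets N).

(* The minimum of a set of values in nat u {+oo} is its infimum in \bar R,
   which is +oo for the empty set. *)
Definition word_norm S g : \bar R :=
  ereal_inf [set (size w)%:R%:E | w in
    [set w : seq G |
      (forall s, s \in w -> (S `|` [set (t^-1)%g | t in S]) s) /\
      (\prod_(s <- w) s)%g = g]].

Definition divisibility P g : \bar R :=
  ereal_inf [set group_index N | N in [set N | P N /\ ~ N g]].

(* For finite S, balls are finite and the supremum below is a maximum. *)
Definition RF P S (r : R) : \bar R :=
  let vals := [set divisibility P g | g in
                [set g | 0 < word_norm S g <= r%:E]] in
  if vals == set0 then 1 else ereal_sup vals.

End ResidualFiniteness.

(* Functions on [1, +oo) are represented by functions on R, of which only the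
   values on [1, +oo) matter. *)
Definition preceq (R : realType) (f g : R -> \bar R) : Prop :=
  exists2 C : R, 0 < C &
    forall r : R, Num.max 1 C^-1 <= r -> (f r <= C%:E * g (C * r)%R)%E.

Definition approxeq (R : realType) (f g : R -> \bar R) : Prop :=
  preceq f g /\ preceq g f.

(* Main.v *)
Require Import Defs.
From HB Require Import structures.
From mathcomp Require Import all_boot all_order all_algebra finmap.
From mathcomp Require Import all_classical all_reals.
From mathcomp Require Import ereal counting_measure.

(** The two comparisons go through maps between the groups that distort word
norms linearly and divisibility by a bounded factor; [RF_preceq] turns such a
map into an inequality of residual finiteness growth.

For the first inequality the map is the inclusion of G1 in G2: an H-invariant
normal subgroup N of G2 that avoids g in G1 traces on G1 an H-invariant normal
subgroup of index at most [G2 : N].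

For the second one, let N be normal in G1 and H-invariant. In general N is not
normal in G2, and the intersection of its conjugates may have a much larger
index. Its normal closure M in G2 has index at most [G2 : G1] [G1 : N] and is
H-invariant, but is larger than N. Nilpotency bounds how much larger: there is
an exponent k, depending only on G1 and G2, such that y ^+ k lies in N for every
y in M ([normal_closure_exp]). Take m > 0 such that all m-th powers of elements
of G2 lie in G1 and use the map g |-> g ^+ (m * k). If N avoids g ^+ (m * k), then
M avoids g ^+ m and hence g; and g ^+ (m * k) is nontrivial for g nontrivial,
because G2 is torsion-free. Since subgroups of finite index are undistorted
([ball_val]), this map distorts norms linearly.

The exponent k is found along the series M_0 = M, M_(i+1) = [M_i, G2], which
reaches 1 because G2 is nilpotent. Modulo M_(i+1), the group M_i is central and
generated by the commutators [n, x_1, ..., x_i] with n in N, which are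
multilinear in the x_j; so the power of exponent m ^ i of such a generator is
congruent to [n, x_1 ^+ m, ..., x_i ^+ m], an element of N since N is normal in
G1 and x_j ^+ m lies in G1. Hence m ^ i-th powers of elements of M_i lie in
N M_(i+1), and the product of the m ^ i over i below the class of G2 serves
as k. *)

Set Implicit Arguments.
Unset Strict Implicit.
Unset Printing Implicit Defensive.

Import Order.TTheory GRing.Theory Num.Theory.

Local Open Scope classical_set_scope.
Local Open Scope group_scope.

(** * Generated subgroups and normal closures *)

Section Generated.
Variable G : groupType.
Implicit Types (A K N : set G) (x y g : G).

Lemma subgroupX N x n : is_subgroup N -> N x -> N (x ^+ n).
Proof. by case=> N1 NM _ Nx; elim: n => // n IH; rewrite expgS; apply: NM. Qed.

Lemma generated_subgroup A : is_subgroup (generated A).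
Proof.
split=> [B [[]] //|x y Ax Ay B [sB AB]|x Ax B [sB AB]].
  by have [_ BM _] := sB; apply: BM; [apply: Ax | apply: Ay].
by have [_ _ BV] := sB; apply: BV; apply: Ax.
Qed.

Lemma sub_generated A : A `<=` generated A.
Proof. exact: sub_smallest. Qed.

Lemma generated_min A N : is_subgroup N -> A `<=` N -> generated A `<=` N.
Proof. by move=> sN AN; apply: smallest_sub. Qed.

Lemma generated_normal A :
  (forall x g, A x -> generated A (x ^ g)) -> is_normal (generated A).
Proof.
move=> AJ; split; first exact: generated_subgroup.
move=> x g; have [G1 GM GV] := generated_subgroup A.
apply: (@generated_min A (fun x => generated A (x ^ g))) => [|z /AJ //].
split=> [|y z Ay Az|y Ay].
- by rewrite conj1g.
- by rewrite conjMg; apply: GM.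
- by rewrite conjVg; apply: GV.
Qed.

Definition commutator_set A : set G :=
  [set z | exists x y, A x /\ z = [~ x, y]].

Definition conjugate_set A : set G :=
  [set z | exists x y, A x /\ z = x ^ y].

Definition normal_closure A : set G := generated (conjugate_set A).

(** The series M_0 = normal closure of A, M_(i+1) = [M_i, G]. *)
Fixpoint closure_series A n : set G :=
  if n is m.+1 then generated (commutator_set (closure_series A m))
  else normal_closure A.

Lemma normal_closure_normal A : is_normal (normal_closure A).
Proof.
apply: generated_normal => _ g [x [y [Ax ->]]].
by apply: sub_generated; exists x, (y * g); rewrite conjgM.
Qed.

Lemma sub_normal_closure A : A `<=` normal_closure A.
Proof. by move=> x Ax; apply: sub_generated; exists x, 1; rewrite conjg1. Qed.

Lemma closure_series_normal A n : is_normal (closure_series A n).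
Proof.
elim: n => [|n [_ IH]]; first exact: normal_closure_normal.
apply: generated_normal => _ g [x [y [Ax ->]]].
by apply: sub_generated; exists (x ^ g), (y ^ g); rewrite conjRg; split=> //; apply: IH.
Qed.

Lemma closure_seriesR A n x y : closure_series A n x -> closure_series A n.+1 [~ x, y].
Proof. by move=> Ax; apply: sub_generated; exists x, y. Qed.

Lemma closure_series_lower_central A n : closure_series A n `<=` lower_central n.
Proof.
elim: n => [//|n IH]; apply: generated_min; first exact: generated_subgroup.
by move=> _ [x [y [Ax ->]]]; apply: sub_generated; exists x, y; split=> //; apply: IH.
Qed.

End Generated.

(** * The quotient by a normal subgroup *)

Section Quotient.
Variables (G : groupType) (K : set G).
Hypothesis nK : is_normal K.
Implicit Types a b c : G.

(** The quotient is carried by a set of representatives of the cosets of K. *)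
Definition coset_repr a : G := xget 1 [set b | K (a^-1 * b)].

Lemma coset_reprP a : K (a^-1 * coset_repr a).
Proof.
have [[K1 _ _] _] := nK.
have /(xgetPex 1) // : exists b, [set b | K (a^-1 * b)] b.
by exists a; rewrite /= mulVg.
Qed.

Lemma coset_repr_eq a b : K (a^-1 * b) <-> coset_repr a = coset_repr b.
Proof.
have [[K1 KM KV] _] := nK; split=> [Kab|eab]; last first.
  have := KM _ _ (coset_reprP a) (KV _ (coset_reprP b)).
  by rewrite eab invgM invgK !mulgA mulgK.
rewrite /coset_repr; congr xget; apply/seteqP; split=> c /= Kc.
  by have := KM _ _ (KV _ Kab) Kc; rewrite invgM invgK !mulgA mulgK.
by have := KM _ _ Kab Kc; rewrite !mulgA mulgK.
Qed.

Lemma coset_reprK a : coset_repr (coset_repr a) = coset_repr a.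
Proof. exact/esym/coset_repr_eq/coset_reprP. Qed.

Lemma coset_reprMl a b : coset_repr (coset_repr a * b) = coset_repr (a * b).
Proof.
have [_ KJ] := nK; apply/esym/coset_repr_eq.
by have := KJ _ b (coset_reprP a); rewrite conjgE invgM !mulgA.
Qed.

Lemma coset_reprMr a b : coset_repr (a * coset_repr b) = coset_repr (a * b).
Proof.
apply/esym/coset_repr_eq; have := coset_reprP b.
by rewrite invgM !mulgA mulgVK.
Qed.

Definition quotient of is_normal K := {a : G | coset_repr a == a}.
Local Notation Q := (quotient nK).
HB.instance Definition _ := Choice.copy Q {a : G | coset_repr a == a}.

Definition quotient_map a : Q := exist _ (coset_repr a) (introT eqP (coset_reprK a)).

Lemma quotient_map_eq a b : quotient_map a = quotient_map b <-> K (a^-1 * b).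
Proof.
rewrite coset_repr_eq; split=> [/(congr1 sval)//|eab].
by apply: val_inj.
Qed.

Lemma quotient_val (x : Q) : quotient_map (sval x) = x.
Proof. by apply: val_inj; apply/eqP/(svalP x). Qed.

Definition quotient_mul (x y : Q) : Q := quotient_map (sval x * sval y).
Definition quotient_inv (x : Q) : Q := quotient_map (sval x)^-1.

Lemma quotient_mapM a b :
  quotient_map (a * b) = quotient_mul (quotient_map a) (quotient_map b).
Proof. by apply: val_inj; rewrite /= coset_reprMl coset_reprMr. Qed.

Lemma quotient_mulgA : associative quotient_mul.
Proof.
move=> x y z; rewrite -(quotient_val x) -(quotient_val y) -(quotient_val z).
by rewrite -!quotient_mapM mulgA.
Qed.

Lemma quotient_mul1g : left_id (quotient_map 1) quotient_mul.
Proof. by move=> x; rewrite -(quotient_val x) -!quotient_mapM mul1g. Qed.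

Lemma quotient_mulg1 : right_id (quotient_map 1) quotient_mul.
Proof. by move=> x; rewrite -(quotient_val x) -!quotient_mapM mulg1. Qed.

Lemma quotient_mulVg : left_inverse (quotient_map 1) quotient_inv quotient_mul.
Proof.
by move=> x; rewrite -{2}(quotient_val x) -quotient_mapM mulVg.
Qed.

Lemma quotient_mulgV : right_inverse (quotient_map 1) quotient_inv quotient_mul.
Proof.
by move=> x; rewrite -{1}(quotient_val x) -quotient_mapM mulgV.
Qed.

HB.instance Definition _ := isGroup.Build Q
  quotient_mulgA quotient_mul1g quotient_mulg1 quotient_mulVg quotient_mulgV.

HB.instance Definition _ := isUMagmaMorphism.Build G Q quotient_map
  (erefl, quotient_mapM).

(** Computing modulo K in a genuine group makes the identities on commuting
elements available. *)
Lemma quotient_exists :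
  exists (Q : groupType) (f : UMagmaMorphism.type G Q),
    forall a b, f a = f b <-> K (a^-1 * b).
Proof. by exists Q, quotient_map; exact: quotient_map_eq. Qed.

End Quotient.

(** * Powers of the normal closure of a normal subgroup of finite index *)

(** Commutators are bilinear as long as they are central. *)
Lemma commgXX (G : groupType) (x y : G) (m n : nat) :
  commute [~ x, y] x -> commute [~ x, y] y ->
  [~ x ^+ m, y ^+ n] = [~ x, y] ^+ (m * n).
Proof.
move=> cx cy.
have cXl k : [~ x ^+ k, y] = [~ x, y] ^+ k.
  elim: k => [|k IH]; first by rewrite !expg0 comm1g.
  have -> : [~ x ^+ k.+1, y] = [~ x ^+ k, y] ^ x * [~ x, y].
    by rewrite expgSr !commgEl conjMg !conjgE !invgM !mulgA !mulgK.
  rewrite IH expgSr; congr (_ * _).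
  by rewrite conjgE (commute_sym (commuteX k (commute_sym cx))) mulKg.
elim: n => [|n IH]; first by rewrite muln0 !expg0 commg1.
have -> : [~ x ^+ m, y ^+ n.+1] = [~ x ^+ m, y] * [~ x ^+ m, y ^+ n] ^ y.
  by rewrite expgSr !commgEl !conjgE !invgM !mulgA !mulgK.
rewrite IH cXl mulnS expgnDr; congr (_ * _).
by rewrite conjgE (commute_sym (commuteX _ (commute_sym cy))) mulKg.
Qed.

Section PowersOfNormalClosure.
Variables (G : groupType) (L N : set G) (m : nat).
Hypothesis LX : forall x, L (x ^+ m).
Hypothesis sN : is_subgroup N.
Hypothesis NJ : forall x g, N x -> L g -> N (x ^ g).
Implicit Types x y g : G.

Lemma closure_series_central i (Q : groupType) (f : UMagmaMorphism.type G Q) :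
  (forall a b, f a = f b <-> closure_series N i.+1 (a^-1 * b)) ->
  forall x y, closure_series N i x -> commute (f x) (f y).
Proof.
move=> fK x y Nx; apply/commgP/eqP; rewrite -gmulfR -[RHS](gmulf1 (s := f)).
by apply/esym/fK; rewrite invg1 mul1g; apply: closure_seriesR.
Qed.

(** The successive quotients of the series are abelian, so taking q-th powers is
a morphism on them and it is enough to look at generators. *)
Lemma closure_series_exp_generated i q A : A `<=` closure_series N i ->
  (forall x, A x -> exists2 n, N n & closure_series N i.+1 (n^-1 * x ^+ q)) ->
  forall x, generated A x -> exists2 n, N n & closure_series N i.+1 (n^-1 * x ^+ q).
Proof.
move=> AM AN.
have [N1 NM NV] := sN; have [sM MJ] := closure_series_normal N i.
have [Q [f fK]] := quotient_exists (closure_series_normal N i.+1).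
have cf := closure_series_central fK.
suff gA : generated A `<=`
    [set x | closure_series N i x /\ exists2 n, N n & f n = f (x ^+ q)].
  by move=> x /gA[_ [n Nn /fK]]; exists n.
have [M1 MM MV] := sM.
apply: generated_min => [|x Ax]; last first.
  by split; [apply: AM | have [n Nn /fK] := AN _ Ax; exists n].
split=> [|x y [Mx [a Na fa]] [My [b Nb fb]]|x [Mx [a Na fa]]].
- by split=> //; exists 1 => //; rewrite expg1n.
- split; first exact: MM.
  exists (a * b); first exact: NM.
  by rewrite gmulfM fa fb !gmulfXn gmulfM expgMn //; apply: cf.
- split; first exact: MV.
  by exists a^-1; [apply: NV | rewrite gmulfV fa !gmulfXn gmulfV expVgn].
Qed.

(** By induction on i: a generator of the next term is [b, y] with b in the
current one and b ^+ (m ^ i) = n * d with n in N and d in the next term.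
Bilinearity gives, two terms down, [b, y] ^+ (m ^ i.+1) = [n * d, y ^+ m] =
[n, y ^+ m], which lies in N because y ^+ m normalizes N. *)
Lemma closure_series_exp i x : closure_series N i x ->
  exists2 n, N n & closure_series N i.+1 (n^-1 * x ^+ (m ^ i)).
Proof.
have [N1 NM NV] := sN.
elim: i x => [|i IH] x.
  apply: closure_series_exp_generated => [|_ [n [y [Nn ->]]]]; first exact: sub_generated.
  (* n ^ y = n * [~ n, y] *)
  exists n => //; rewrite expg1 -commgEl.
  by apply: closure_seriesR; apply: sub_normal_closure.
apply: closure_series_exp_generated => [|_ [b [y [Mb ->]]]]; first exact: sub_generated.
have [Q [f fK]] := quotient_exists (closure_series_normal N i.+2).
have cf := closure_series_central fK.
have [n Nn Md] := IH _ Mb.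
exists [~ n, y ^+ m].
  by rewrite commgEl; apply: NM; [apply: NV | apply: NJ => //; apply: LX].
apply/fK; rewrite expnSr gmulfXn [in RHS]gmulfR.
have cb z : commute [~ f b, f y] (f z).
  by rewrite -gmulfR; apply: cf; apply: closure_seriesR.
rewrite -commgXX // -!gmulfXn gmulfR.
(* d lies in the term after that of b, so f d is central. *)
rewrite -[b ^+ _](mulVKg n) gmulfM; move: Md; set d := n^-1 * _ => Md.
rewrite !commgEr conjgM -gmulfV -gmulfJ [in RHS]conjgE.
by rewrite -[f _ * f d](cf _ _ Md) mulKg.
Qed.

(** Descending one step of the series costs an m ^ i-th power; the class c bounds
the number of steps, so that the exponent is independent of N. *)
Lemma normal_closure_exp c x : lower_central c = [set 1 : G] ->
  normal_closure N x -> N (x ^+ (m ^ (\sum_(i < c) i))).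
Proof.
have [N1 NM NV] := sN => Lc Mx.
suff [n Nn Md] : exists2 n, N n & closure_series N c (n^-1 * x ^+ (m ^ (\sum_(i < c) i))).
  move: Md => /closure_series_lower_central; rewrite Lc => /= /mulg1_eq.
  by rewrite invgK => <-.
elim: c {Lc} => [|c [n Nn Md]].
  by exists 1 => //; rewrite big_ord0 expn0 expg1 invg1 mul1g.
have [Q [f fK]] := quotient_exists (closure_series_normal N c.+1).
have cf := closure_series_central fK.
have [k Nk /fK Mk] := closure_series_exp Md.
exists (n ^+ (m ^ c) * k); first by apply: NM => //; apply: subgroupX.
apply/fK; rewrite big_ord_recr /= expnD expgnA gmulfM Mk !gmulfXn.
rewrite -expgMn; last by apply: commute_sym; apply: cf.
by rewrite -gmulfM mulVKg !gmulfXn.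
Qed.

End PowersOfNormalClosure.

(** * Balls of the word norm *)

Section Balls.
Variables (G : groupType) (S : set G).
Implicit Types (n : nat) (x y g : G) (A : set G).

Definition letters : set G := S `|` [set t^-1 | t in S].

Definition ball n g := exists w : seq G,
  [/\ forall s, s \in w -> letters s, (size w <= n)%N & \prod_(s <- w) s = g].

Lemma lettersV s : letters s -> letters s^-1.
Proof. by case=> [Ss|[t St <-]]; [right; exists s | left; rewrite invgK]. Qed.

Lemma finite_letters : finite_set S -> finite_set letters.
Proof. by move=> fS; rewrite finite_setU; split=> //; apply: finite_image. Qed.

Lemma ball_le n n' g : (n <= n')%N -> ball n g -> ball n' g.
Proof. by move=> nn' [w [Sw wn <-]]; exists w; split=> //; apply: leq_trans nn'. Qed.

Lemma ball1 n : ball n 1.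
Proof. by exists [::]; rewrite big_nil. Qed.

Lemma ball0 g : ball 0 g -> g = 1.
Proof. by case=> [[|s w] [_ // _ <-]]; rewrite big_nil. Qed.

Lemma ball_letter s : letters s -> ball 1 s.
Proof.
by move=> Ss; exists [:: s]; rewrite big_seq1; split=> // t /[!inE] /eqP ->.
Qed.

Lemma ballM n n' x y : ball n x -> ball n' y -> ball (n + n') (x * y).
Proof.
move=> [v [Sv vn <-]] [w [Sw wn <-]]; exists (v ++ w).
rewrite big_cat size_cat leq_add //; split=> // s.
by rewrite mem_cat => /orP[/Sv|/Sw].
Qed.

Lemma ballX n k x : ball n x -> ball (k * n) (x ^+ k).
Proof.
move=> nx; elim: k => [|k IH]; first exact: ball1.
by rewrite expgS mulSn; apply: ballM.
Qed.

Lemma ballV n x : ball n x -> ball n x^-1.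
Proof.
move=> [w [Sw wn <-]]; exists [seq s^-1 | s <- rev w]; split.
- by move=> _ /mapP[s /[!mem_rev] /Sw Ss ->]; apply: lettersV.
- by rewrite size_map size_rev.
- by rewrite big_map prodgV revK.
Qed.

Lemma generated_ball g : generated S g -> exists n, ball n g.
Proof.
apply: (@generated_min _ S (fun g => exists n, ball n g)) => [|s Ss]; last first.
  by exists 1%N; apply: ball_letter; left.
split=> [|x y [n nx] [n' ny]|x [n nx]].
- by exists 0%N; apply: ball1.
- by exists (n + n')%N; apply: ballM.
- by exists n; apply: ballV.
Qed.

Lemma finite_ball A : generated S = [set: G] -> finite_set A ->
  exists n, forall a, A a -> ball n a.
Proof.
move=> gS /finite_seqP[s ->]; elim: s => [|a s [n IH]]; first by exists 0%N.
have [k ka] : exists k, ball k a by apply: generated_ball; rewrite gS.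
exists (n + k)%N => b; rewrite /= inE => /orP[/eqP ->|/IH nb].
  by apply: ball_le ka; apply: leq_addl.
by apply: ball_le nb; apply: leq_addr.
Qed.

Variable R : realType.

(** The infimum defining the word norm is one of natural numbers, hence it is
attained when finite. *)
Lemma word_norm_leP (r : R) g : (0 <= r)%R ->
  (word_norm R S g <= r%:E)%E <-> exists2 n, (n%:R <= r)%R & ball n g.
Proof.
move=> r0; split=> [gr|[n nr [w [Sw wn wg]]]]; last first.
  apply: ge_ereal_inf; exists (size w)%:R%:E; first by exists w.
  by rewrite lee_fin (le_trans _ nr)// ler_nat.
have /ereal_inf_lt[_ [w [Sw wg] <-]] :
    (word_norm R S g < (Num.truncn r).+1%:R%:E)%E.
  by rewrite (le_lt_trans gr)// lte_fin truncnS_gt.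
rewrite lte_fin ltr_nat ltnS => wr; exists (size w); last by exists w.
by rewrite -truncn_ge_nat.
Qed.

Lemma word_norm_gt0 g : (0 < word_norm R S g)%E <-> g <> 1.
Proof.
split=> [g0 g1|g1].
  move: g0; apply/negP; rewrite -leNgt; apply/(word_norm_leP _ (lexx 0%R)).
  by exists 0%N => //; rewrite g1; apply: ball1.
rewrite ltNge; apply/negP => /(word_norm_leP _ (lexx 0%R))[n].
by rewrite lern0 => /eqP -> /ball0.
Qed.

End Balls.

Section Lipschitz.
Variables (G : groupType) (P : pred G) (G1 : subGroupType P).
Variables (S : set G) (S1 : set G1).

Lemma valV (u : G1) : val u^-1 = (val u)^-1 :> G.
Proof. exact: gmulfV. Qed.

Lemma val_ball : finite_set S1 -> generated S = [set: G] ->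
  exists C, forall n u, ball S1 n u -> ball S (C * n) (val u).
Proof.
move=> fS1 gS.
have [C CS] := finite_ball gS (finite_image val (finite_letters fS1)).
exists C => n u [w [Sw wn <-]]; apply: (@ball_le _ _ (C * size w)).
  by rewrite leq_mul2l wn orbT.
elim: w Sw {wn} => [|s w IH] Sw; first by rewrite big_nil val1; apply: ball1.
rewrite big_cons valM mulnS; apply: ballM.
  by apply: CS; exists s => //; apply: Sw; rewrite mem_head.
by apply: IH => t tw; apply: Sw; rewrite inE tw orbT.
Qed.

Lemma transversal : finite_index [set` P] ->
  exists T : set G, [/\ finite_set T, T 1 & forall x, exists2 t, T t & P (t^-1 * x)].
Proof.
move=> fP; exists (1 |` [set xget 1 A | A in left_cosets [set` P]]); split.
- by rewrite finite_setU; split=> //; apply: finite_image.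
- by left.
move=> x; set A := [set x * y | y in [set` P]].
have [y Py xy] : A (xget 1 A).
  apply: (xgetPex 1); exists x, 1; last by rewrite mulg1.
  by have := valP (1 : G1); rewrite val1.
exists (xget 1 A); first by right; exists A => //; exists x.
rewrite -xy invgM mulgVK.
by rewrite -(SubK G1 Py) -valV; apply: valP.
Qed.

(** Schreier's rewriting: reading a word from its end and keeping the transversal
element t of the current suffix, each letter s contributes one of the finitely
many elements t'^-1 * s * t of G1. The unit is added to the letters so that the
final change from t to 1 has the same form. *)
Lemma ball_val : finite_index [set` P] -> finite_set S ->
  generated S1 = [set: G1] ->
  exists C, forall n u, ball S n (val u) -> ball S1 (C * n.+1) u.
Proof.
move=> fP fS gS1; have [T [fT T1 TP]] := transversal fP.
have fE : finite_set (val @^-1` [set es * t |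
    es in [set t'^-1 * s | t' in T & s in 1 |` letters S] & t in T] : set G1).
  apply: finite_preimage; first by move=> ? ? _ _ /val_inj.
  apply: finite_image2 => //; apply: finite_image2 => //.
  by rewrite finite_setU; split=> //; apply: finite_letters.
have [C CE] := finite_ball gS1 fE.
have {}CE t' s t (u : G1) : T t' -> (1 |` letters S) s -> T t ->
    val u = t'^-1 * s * t -> ball S1 C u.
  by move=> Tt' Ss Tt ue; apply: CE => /=; rewrite ue; exists (t'^-1 * s);
     [exists t' => //; exists s | exists t].
exists C => n u [w [Sw wn wu]]; apply: (@ball_le _ _ (C * (size w).+1)).
  by rewrite leq_mul2l ltnS wn orbT.
suff [t Tt [v vw pw]] : exists2 t, T t &
    exists2 v, ball S1 (C * size w) v & \prod_(s <- w) s = t * val v.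
  rewrite mulnS -(mulgVK v u); apply: ballM => //.
  apply: (CE 1 1 t) => //; first by left.
  by rewrite valM valV -wu pw mulgK invg1 !mul1g.
elim: w Sw {wn wu} => [|s w IH] Sw.
  by exists 1 => //; exists 1; [apply: ball1 | rewrite big_nil val1 mulg1].
have [t Tt [v vw pw]] : exists2 t, T t &
    exists2 v, ball S1 (C * size w) v & \prod_(s <- w) s = t * val v.
  by apply: IH => t tw; apply: Sw; rewrite inE tw orbT.
have [t' Tt' Pt'] := TP (s * t).
exists t' => //; exists (Sub _ Pt' * v).
  rewrite /= mulnS; apply: ballM => //; apply: (CE t' s t) => //.
    by right; apply: Sw; rewrite mem_head.
  by rewrite SubK mulgA.
by rewrite big_cons pw valM SubK !mulgA mulgV mul1g.
Qed.

(** Among the powers of x of exponent at most the index, two lie in the same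
coset, and the difference of their exponents divides the factorial of the
index, an exponent that does not depend on x. *)
Lemma finite_index_exp : finite_index [set` P] ->
  exists2 m, (0 < m)%N & forall x, P (x ^+ m).
Proof.
move=> /finite_seqP[s sE].
have Pcoset x : left_cosets [set` P] [set x * y | y in [set` P]] by exists x.
exists (size s)`!; first exact: fact_gt0.
move=> x; pose c i := [set x ^+ i * y | y in [set` P]].
have /(uniqPn set0)[i [j [ij]]] : ~~ uniq (map c (iota 0 (size s).+1)).
  apply/negP => Uc; have : (size (map c (iota 0 (size s).+1)) <= size s)%N.
    apply: uniq_leq_size => // _ /mapP[i _ ->].
    by have := Pcoset (x ^+ i); rewrite sE.
  by rewrite size_map size_iota ltnn.
rewrite size_map size_iota => js; rewrite !(nth_map 0%N) ?size_iota//; last first.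
  exact: ltn_trans js.
rewrite !nth_iota ?(ltn_trans ij)// !add0n => cij.
have [y Py xy] : c i (x ^+ j).
  by rewrite cij; exists 1; [have := valP (1 : G1); rewrite val1 | rewrite mulg1].
have Pk : P (x ^+ (j - i)).
  suff -> : x ^+ (j - i) = y by [].
  by apply: (@mulgI _ (x ^+ i)); rewrite -expgnDr subnKC // ltnW.
have /dvdnP[q ->] : (j - i %| (size s)`!)%N.
  by apply: dvdn_fact; rewrite subn_gt0 ij leq_subLR (leq_trans _ (leq_addl _ _)).
rewrite mulnC expgnA.
rewrite -(SubK G1 Pk) -gmulfXn; exact: valP.
Qed.
End Lipschitz.

(** * Comparison of indices *)

Section Counting.
Variable R : realType.

Lemma counting_ge1 (T : choiceType) (X : set T) :
  X !=set0 -> (1 <= counting X :> \bar R)%E.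
Proof.
move=> [x Xx]; rewrite /counting; case: asboolP => // fX; last exact: leey.
rewrite lee_fin ler1n -[1%N]/(size [:: x]); apply: uniq_leq_size => // y.
by rewrite inE => /eqP ->; rewrite in_fset_set // inE.
Qed.

Lemma counting_image2 (T U V : choiceType) (X : set V) (A : set T) (B : set U)
    (f : T -> U -> V) : finite_set A -> A !=set0 ->
  X `<=` [set f a b | a in A & b in B] ->
  (counting X <= #|` fset_set A|%:R%:E * counting B :> \bar R)%E.
Proof.
move=> fA [a Aa] XAB; rewrite [in leRHS]/counting; case: asboolP => fB; last first.
  rewrite gt0_muley ?leey// lte_fin ltr0n cardfs_gt0.
  by apply/fset0Pn; exists a; rewrite in_fset_set // inE.
have fX : finite_set X by apply: sub_finite_set XAB _; apply: finite_image2.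
rewrite /counting asboolT // -EFinM lee_fin -natrM ler_nat.
rewrite -(size_allpairs f); apply: uniq_leq_size => [|x]; first exact: fset_uniq.
rewrite in_fset_set // inE => /XAB[b Ab [c Bc <-]].
by apply: allpairs_f; rewrite in_fset_set // inE.
Qed.

Lemma group_index_ge1 (G : groupType) (N : set G) : (1 <= group_index R N)%E.
Proof. by apply: counting_ge1; exists [set 1 * x | x in N]; exists 1. Qed.

Lemma divisibility_ge1 (G : groupType) (N : set (set G)) g :
  (1 <= divisibility R N g)%E.
Proof. by apply/ereal_infP => _ [M _ <-]; apply: group_index_ge1. Qed.

Lemma RF_ge1 (G : groupType) (N : set (set G)) S (r : R) : (1 <= RF N S r)%E.
Proof.
rewrite /RF; case: ifPn => // /set0P[_ [g gr _]].
apply: le_ereal_sup_tmp; exists (divisibility R N g); first by exists g.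
exact: divisibility_ge1.
Qed.

(** Two bounds C and D are merged into one constant, increased by 1 to make it
positive also for the comparison of the values 1 on empty balls. *)
Lemma RF_preceq (G G' : groupType) (NN : set (set G)) (NN' : set (set G'))
    (S : set G) (S' : set G') (phi : G -> G') (C D : nat) :
  (forall g, g <> 1 -> phi g <> 1) ->
  (forall n g, ball S n g -> ball S' (C * n) (phi g)) ->
  (forall g, g <> 1 -> (divisibility R NN g <= D%:R%:E * divisibility R NN' (phi g))%E) ->
  preceq (@RF R G NN S) (@RF R G' NN' S').
Proof.
move=> phi1 phiB phiD; pose K := (C + D).+1.
exists K%:R%R => [|r]; first by rewrite ltr0n.
rewrite ge_max => /andP[r1 _].
have r0 : (0 <= r)%R by rewrite (le_trans _ r1).
rewrite {1}/RF; case: ifPn => [_|_].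
  by rewrite -[leLHS]mule1 lee_pmul ?RF_ge1 // lee_fin ler1n.
apply/ereal_supP => _ [g /= /andP[/word_norm_gt0 g1 /(word_norm_leP _ _ r0)[n nr ng]] <-].
apply: (le_trans (phiD _ g1)); apply: lee_pmul.
- by rewrite lee_fin.
- exact: le_trans (divisibility_ge1 _ _).
- by rewrite lee_fin ler_nat /K ltnW // ltnS leq_addl.
have vphi : [set divisibility R NN' h | h in
    [set h | (0 < word_norm R S' h <= (K%:R * r)%:E)%E]] (divisibility R NN' (phi g)).
  exists (phi g) => //=; apply/andP; split; first by apply/word_norm_gt0/phi1.
  apply/word_norm_leP; first by rewrite mulr_ge0.
  exists (C * n)%N; last exact: phiB.
  rewrite natrM ler_pM // ler_nat /K (leq_trans (leq_addr D C)) //.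
rewrite /RF ifF; last by apply/negbTE/set0P; eexists; exact: vphi.
by apply: le_ereal_sup_tmp; exists (divisibility R NN' (phi g)).
Qed.

End Counting.

(** * Invariant normal subgroups of a group and of a subgroup *)

Section SubgroupComparison.
Variables (R : realType) (G : groupType) (P : pred G) (G1 : subGroupType P).
Variable H : set (G -> G).

Lemma group_index_preimage (N : set G) : is_subgroup N ->
  (group_index R (val @^-1` N : set G1) <= group_index R N)%E.
Proof.
move=> [_ NM NV]; rewrite -[leRHS]mul1e.
have -> : 1%E = (#|` fset_set [set tt]|)%:R%:E :> \bar R.
  by rewrite fset_set1 cardfs1.
apply: (@counting_image2 R _ _ _ _ _ _ (fun _ (y : set G) => val @^-1` y)) =>
  [||_ [u _ <-]].
- exact: finite_set1.
- by exists tt.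
exists tt => //; exists [set val u * x | x in N]; first by exists (val u).
apply/seteqP; split=> [v [x Nx uxv]|_ [v Nv <-]] /=; last first.
  by exists (val v); rewrite ?valM.
exists (u^-1 * v); last by rewrite mulVKg.
by rewrite /= valM valV -uxv mulKg.
Qed.

(** The coset of x = t * u modulo M depends on u only through its coset
modulo N. *)
Lemma group_index_overgroup (T : set G) (N : set G1) (M : set G) :
  finite_set T -> T !=set0 -> (forall x, exists2 t, T t & P (t^-1 * x)) ->
  is_subgroup M -> val @` N `<=` M -> N 1 ->
  (group_index R M <= (#|` fset_set T|)%:R%:E * group_index R N)%E.
Proof.
move=> fT T0 TP [M1 MM MV] NM N1.
apply: (@counting_image2 R _ _ _ _ _ _ (fun t (A : set G1) =>
  [set t * val a * z | a in A & z in M])) => // _ [x _ <-].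
have [t Tt Pu] := TP x; exists t => //.
pose u : G1 := Sub _ Pu.
exists [set u * a | a in N]; first by exists u.
have xE : t * val u = x by rewrite SubK mulgA mulgV mul1g.
apply/seteqP; split=> [_ [_ [a Na <-]] [z Mz <-]|_ [z Mz <-]].
  exists (val a * z); first by apply: MM => //; apply: NM; exists a.
  by rewrite valM !mulgA xE.
exists (u * 1); first by exists 1.
by exists z => //; rewrite mulg1 xE.
Qed.

Hypothesis H_aut : is_aut_subgroup H.
Hypothesis HP : is_invariant H [set` P].

Lemma aut_P xi x : H xi -> P (xi x) <-> P x.
Proof.
move=> Hxi; have [Haut _ _ _] := H_aut; have [/bij_inj xiI _] := Haut _ Hxi.
have xiP := HP Hxi; split=> [Pxi|Px].
  have : [set` P] (xi x) by [].
  by rewrite -xiP => -[y Py /xiI <-].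
have : (xi @` [set` P]) (xi x) by exists x.
by rewrite xiP.
Qed.

(** Invariance under the restrictions would say nothing about a map of H without
a restriction. *)
Lemma restriction_exists xi : H xi ->
  exists2 h, restrictions (G1 := G1) H h & forall u, val (h u) = xi (val u).
Proof.
move=> Hxi; have Pxi (u : G1) : P (xi (val u)) by apply/(aut_P _ Hxi)/valP.
exists (fun u => Sub _ (Pxi u)) => [|u]; last by rewrite SubK.
by exists xi => // u; rewrite SubK.
Qed.

Lemma preimage_invariant_normal (N : set G) : invariant_normals H N ->
  invariant_normals (restrictions (G1 := G1) H) (val @^-1` N : set G1).
Proof.
move=> [[[N1 NM NV] NJ] NH]; split; first split; first split=> [|x y|x] /=.
- by rewrite val1.
- by rewrite valM; apply: NM.
- by rewrite valV; apply: NV.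
- by move=> x g /=; rewrite conjgE !valM valV; apply: NJ.
move=> h [xi Hxi hE]; have NE := NH _ Hxi; apply/seteqP; split=> [_ [u Nu <-]|u Nu] /=.
  by rewrite hE -NE; exists (val u).
move: (Nu) => /=; rewrite -{1}NE => -[x Nx xu].
have Px : P x by apply/(aut_P _ Hxi); rewrite xu; apply: valP.
exists (Sub x Px); first by rewrite /= SubK.
by apply: val_inj; rewrite hE SubK.
Qed.

Lemma normal_closure_invariant (N : set G1) :
  is_invariant (restrictions (G1 := G1) H) N ->
  is_invariant H (normal_closure (val @` N)).
Proof.
move=> NH.
have sub xi x : H xi -> normal_closure (val @` N) x -> normal_closure (val @` N) (xi x).
  move=> Hxi; have [Haut _ _ _] := H_aut; have [_ xiM] := Haut _ Hxi.
  have xi1 : xi 1 = 1 by apply: (@mulgI _ (xi 1)); rewrite -xiM !mulg1.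
  have xiV y : xi y^-1 = (xi y)^-1.
    by apply: (@mulgI _ (xi y)); rewrite -xiM !mulgV.
  have [[M1 MM MV] MJ] := normal_closure_normal (val @` N).
  apply: (@generated_min _ _ (fun x => normal_closure (val @` N) (xi x))).
    split=> [|y z My Mz|y My]; first by rewrite xi1.
      by rewrite xiM; apply: MM.
    by rewrite xiV; apply: MV.
  move=> _ [_ [y [[u Nu <-] ->]]]; rewrite conjgE !xiM xiV.
  apply: MJ; apply: sub_normal_closure.
  have [h Hh hE] := restriction_exists Hxi.
  by exists (h u) => //; rewrite -(NH _ Hh); exists u.
move=> xi Hxi; have [_ _ _ /(_ _ Hxi)[h Hh [xiK hK]]] := H_aut.
apply/seteqP; split=> [_ [x Mx <-]|x Mx]; first exact: sub.
by exists (h x); [apply: sub | rewrite hK].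
Qed.

Lemma normal_closure_avoids (N : set G1) c m (u : G1) :
  is_normal N -> lower_central c = [set 1 : G] -> (forall x : G, P (x ^+ m)) ->
  normal_closure (val @` N) (val u) -> N (u ^+ (m ^ (\sum_(i < c) i))).
Proof.
move=> [[N1 NM NV] NJ] Lc Pm Mu.
suff [v Nv vu] : (val @` N) (val u ^+ (m ^ (\sum_(i < c) i))).
  suff -> : u ^+ (m ^ (\sum_(i < c) i)) = v by [].
  by apply: val_inj; rewrite vu gmulfXn.
apply: (@normal_closure_exp _ [set` P]) Mu => //.
  split=> [|_ _ [x Nx <-] [y Ny <-]|_ [x Nx <-]].
  - by exists 1; rewrite ?val1.
  - by exists (x * y); [apply: NM | rewrite valM].
  - by exists x^-1; [apply: NV | rewrite valV].
move=> _ g [x Nx <-] Pg; exists (x ^ (Sub g Pg)); first exact: NJ.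
by rewrite !conjgE !valM valV SubK.
Qed.

End SubgroupComparison.

Theorem theorem3 (R : realType) (G2 : groupType) (P : pred G2)
    (G1 : subGroupType P) (H : set (G2 -> G2))
    (G2_torsion_free : torsion_free G2)
    (G2_fg : finitely_generated G2)
    (G2_nilpotent : is_nilpotent G2)
    (G1_normal : is_normal [set` P])
    (G1_finite_index : finite_index [set` P])
    (H_aut : is_aut_subgroup H)
    (G1_invariant : is_invariant H [set` P])
    (S1 : set G1) (S1_gen : finite_generating_set S1)
    (S2 : set G2) (S2_gen : finite_generating_set S2) :
  approxeq (@RF R G1 (invariant_normals (restrictions (G1 := G1) H)) S1)
           (@RF R G2 (invariant_normals H) S2).
Proof.
have [[fS1 gS1] [fS2 gS2]] := (S1_gen, S2_gen); split.
  have [C CB] := val_ball fS1 gS2.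
  apply: (@RF_preceq R _ _ _ _ _ _ val C 1) => // [u u1 vu1|u _].
    by apply: u1; apply: val_inj; rewrite vu1 val1.
  rewrite mul1e; apply/ereal_infP => _ [N [HN Nu] <-].
  apply: (@le_trans _ _ (group_index R (val @^-1` N : set G1))).
    apply: ge_ereal_inf; exists (group_index R (val @^-1` N : set G1)) => //.
    by exists (val @^-1` N) => //; split=> //; apply: preimage_invariant_normal.
  by apply: group_index_preimage; case: HN => -[].
have [m m0 Pm] := finite_index_exp G1 G1_finite_index.
have [c Lc] := G2_nilpotent; pose k := (m ^ (\sum_(i < c) i))%N.
have [C CB] := ball_val G1_finite_index fS2 gS1.
have [T [fT T1 TP]] := transversal G1 G1_finite_index.
pose phi g : G1 := Sub (g ^+ m) (Pm g) ^+ k.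
have phiE g : val (phi g) = g ^+ (m * k) by rewrite expgnA -(SubK G1 (Pm g)) -gmulfXn.
apply: (@RF_preceq R _ _ _ _ _ _ phi (C * (m * k).+1) #|` fset_set T|).
- move=> g g1 phig1; apply: g1; apply: (G2_torsion_free _ (m * k)%N).
    by rewrite muln_gt0 m0 expn_gt0 m0.
  by rewrite -phiE phig1 val1.
- case=> [|n] g ng.
    by rewrite muln0 /phi (_ : Sub _ _ = 1) ?expg1n; [apply: ball1 |
      apply: val_inj; rewrite SubK val1 (ball0 ng) expg1n].
  have : ball S1 (C * (m * k * n.+1).+1) (phi g).
    by apply: CB; rewrite phiE; apply: ballX.
  by apply: ball_le; rewrite -[leqRHS]mulnA leq_mul2l mulSn addSn ltnS leq_addl orbT.
move=> g g1.
have T0 : T !=set0 by exists 1.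
have T_gt0 : (0 < #|` fset_set T|%:R :> R)%R.
  by rewrite ltr0n cardfs_gt0; apply/fset0Pn; exists 1; rewrite in_fset_set // inE.
rewrite -ereal_inf_pZl //; apply/ereal_infP => _ [_ [N [[nN HN] Ng] <-] <-].
pose M := normal_closure (val @` N : set G2).
apply: (@le_trans _ _ (group_index R M)); last first.
  apply: group_index_overgroup => //; last by case: nN => -[].
    by case: (normal_closure_normal (val @` N)).
  exact: sub_normal_closure.
apply: ge_ereal_inf; exists (group_index R M) => //; exists M => //; split.
  by split; [apply: normal_closure_normal | apply: normal_closure_invariant].
move=> Mg; apply: Ng; apply: normal_closure_avoids => //.
rewrite SubK; apply: subgroupX Mg.
by case: (normal_closure_normal (val @` N)).
Qed.
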